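(* Let $(X_i)_{i=1}^\infty$ be independent with $X_i\sim\mathrm{Exp}(i)$ and $M=\sup_{i\ge1}X_i$. Then for every integer $k\ge1$, $$ \begin{aligned} E(M^k)= k!(-1)^k\Bigg(&-6^k\Big(\frac{2\pi}{3\sqrt3}-1\Big)\binom{2k-2}{k-1} +\sum_{j=1}^{\lfloor k/2\rfloor}2^{k+1}\binom{2k-2j-1}{k-1}3^{k-2j}\zeta(2j)\big(1-2^{1-2j}\big)\\ &+\sum_{j=2}^{k}\binom{2k-j-1}{k-1}6^{k-j}\Big((-1)^j\big(\zeta(j,\tfrac13)-\zeta(j,\tfrac56)\big)+\zeta(j,\tfrac23)-\zeta(j,\tfrac16)+6^j\Big)\Bigg). \end{aligned} $$
   Context: $\mathrm{Exp}(\lambda)$ denotes the exponential distribution with rate $\lambda$ (density $\lambda e^{-\lambda x}$, $x\ge0$). $\zeta(s)$ is the Riemann zeta function and $\zeta(s,a)$ is Hurwitz's zeta function, defined for $\mathrm{Re}\,s>1$, $\mathrm{Re}\,a>0$ by $\zeta(s,a)=\sum_{m=0}^\infty (m+a)^{-s}$ (and by analytic continuation in $s$ elsewhere, with a single simple pole at $s=1$). *)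

(* Defs.v *)
From HB Require Import structures.
From mathcomp Require Import all_boot all_order all_algebra finmap.
From mathcomp Require Import all_classical all_reals all_analysis.
Set Implicit Arguments. Unset Strict Implicit. Unset Printing Implicit Defensive.
Import Order.TTheory GRing.Theory Num.Theory.
Local Open Scope classical_set_scope.
Local Open Scope ring_scope.

(* Hurwitz zeta function zeta(s,a) = sum_{m>=0} (m+a)^{-s}, given by its
   defining (convergent) series; it is only used for integer s >= 2 and a > 0,
   where the series converges. *)
Definition hurwitz_zeta {R : realType} (s : nat) (a : R) : R :=
  limn (fun n : nat => \sum_(0 <= m < n) ((m%:R + a) ^- s)).

Definition riemann_zeta {R : realType} (s : nat) : R := hurwitz_zeta s 1.

Definition mutually_independent d (T : measurableType d) {R : realType}
    (P : probability T R) (I : set nat) (X : nat -> {RV P >-> R}) : Prop :=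
  forall (J : {fset nat}), [set` J] `<=` I ->
  forall B : nat -> set R, (forall i, i \in J -> measurable (B i)) ->
    P (\bigcap_(i in [set` J]) (X i @^-1` B i)) =
    (\prod_(i <- J) P (X i @^-1` B i))%E.

Definition supRV d (T : measurableType d) {R : realType}
    (P : probability T R) (X : nat -> {RV P >-> R}) (w : T) : \bar R :=
  ereal_sup [set (X i w)%:E | i in [set i : nat | (0 < i)%N]].

Arguments mutually_independent {d T R} P I X.
Arguments supRV {d T R} P X w.

(* Main.v *)
Require Import Defs.
From HB Require Import structures.
From mathcomp Require Import all_boot all_order all_algebra finmap.
From mathcomp Require Import all_classical all_reals all_analysis.
From mathcomp Require Import measurable_realfun.
From mathcomp Require Import ring lra zify.
Import Order.TTheory GRing.Theory Num.Theory.
Import numFieldNormedType.Exports.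
Local Open Scope classical_set_scope.
Local Open Scope ring_scope.

(* The maximum of X_1, ..., X_n has distribution function P_n(q) = prod_(i
   <= n) (1 - q^i) at q = e^{-t}, so E (max)^k is the integral of k t^(k-1) (1
   - P_n(e^{-t})).  Shanks' finite form of Euler's pentagonal number theorem
   replaces 1 - P_n(q) by an alternating sum of q^(s (3 s -+ 1) / 2), s <= n,
   up to an error bounded by sum_(s <= n) q^(s n), whose contribution k! sum_s
   (s n)^(-k) is at most k! times the n-th arithmetic mean of the harmonic
   sequence.  Hence E M^k = k! sum_(s >= 1) (-1)^(s+1) ((2 / (s (3 s - 1)))^k +
   (2 / (s (3 s + 1)))^k).  With u = 1 / (3 s) and v = 1 / (1 - 3 s) one has 2
   / (s (3 s - 1)) = -6 u v and u + v = u v, so partial fractions split the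
   k-th powers into alternating sums of s^-j and (s +- 1/3)^-j; grouping
   consecutive terms gives zeta values, and the conditionally convergent case j
   = 1 is an arctangent. *)

(** * Algebraic identities *)

(** The term [s = 0] on the left is the product P_n(q); the exponents on the right are the
    pentagonal numbers s (3 s - 1) / 2 and s (3 s + 1) / 2. Induction on [n] adds exactly the pair
    with s = n + 1. *)
Lemma pentagonal_finite (A : comPzRingType) (q : A) (n : nat) :
  \sum_(0 <= s < n.+1) (-1) ^+ s * (\prod_(s <= i < n) (1 - q ^+ i.+1)) *
     q ^+ (s * n + 'C(s.+1, 2)) =
  1 + \sum_(1 <= s < n.+1) (-1) ^+ s *
     (q ^+ (s ^ 2 + 'C(s, 2)) + q ^+ (s ^ 2 + 'C(s.+1, 2))).
Proof.
elim: n => [|n IHn].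
  by rewrite big_nat1 big_geq// big_geq// !expr0 !mulr1 addr0.
pose Q s := \prod_(s <= i < n) (1 - q ^+ i.+1).
(* Raising [n] by one changes the sum over s <= m only by a boundary term. At m = n this term is one
   of the two new pentagonal powers; the term s = n + 1 of the longer sum is the other. *)
have telesc m : (m <= n)%N ->
  \sum_(0 <= s < m.+1) (-1) ^+ s * (Q s * (1 - q ^+ n.+1)) *
      q ^+ (s * n.+1 + 'C(s.+1, 2)) =
  \sum_(0 <= s < m.+1) (-1) ^+ s * Q s * q ^+ (s * n + 'C(s.+1, 2)) +
  (-1) ^+ m.+1 * Q m * q ^+ (m.+1 * n.+1 + 'C(m.+1, 2)).
  elim: m => [_|m IHm mn].
    rewrite !big_nat1 !mul0n !add0n mul1n (_ : 'C(1, 2) = 0%N)// addn0.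
    ring.
  rewrite big_nat_recr//= IHm ?(ltnW mn)// [in RHS]big_nat_recr//=.
  have -> : Q m = (1 - q ^+ m.+1) * Q m.+1 by rewrite /Q big_ltn.
  have -> : 'C(m.+2, 2) = ('C(m.+1, 2) + m.+1)%N by rewrite binS bin1.
  rewrite -!addrA; congr (_ + _).
  have -> : (m.+1 * n.+1 + ('C(m.+1, 2) + m.+1) =
    (m.+1 * n + 'C(m.+1, 2) + m.+1) + m.+1)%N by lia.
  have -> : (m.+2 * n.+1 + ('C(m.+1, 2) + m.+1) =
    (m.+1 * n + 'C(m.+1, 2) + m.+1) + m.+1 + n.+1)%N by lia.
  have -> : (m.+1 * n + ('C(m.+1, 2) + m.+1) =
    (m.+1 * n + 'C(m.+1, 2) + m.+1))%N by lia.
  have -> : (m.+1 * n.+1 + 'C(m.+1, 2) =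
    (m.+1 * n + 'C(m.+1, 2) + m.+1))%N by lia.
  move: (m.+1 * n + 'C(m.+1, 2))%N => e.
  by rewrite !exprD !(exprS (-1)); ring.
rewrite big_nat_recr//= [in RHS]big_nat_recr//= addrA -{}IHn.
rewrite (big_geq (leqnn n.+1)) mulr1.
rewrite (eq_big_nat _ _ (F2 := fun s => (-1) ^+ s * (Q s * (1 - q ^+ n.+1)) *
      q ^+ (s * n.+1 + 'C(s.+1, 2)))); last first.
  by move=> s /andP[_ sn]; rewrite /Q big_nat_recr.
rewrite telesc// -addrA; congr (_ + _).
by rewrite /Q big_geq// mulr1 mulrDr mulnn.
Qed.

(** The relation turns u^(m+1) v^(n+1) into a sum of two products of lower total degree, and [S]
    obeys the same recursion by Pascal's rule. The intended instance is u = 1 / x, v = 1 / (1 -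
    x). *)
Lemma partial_fractions (A : comPzRingType) (u v : A) (m n : nat) :
  u + v = u * v ->
  u ^+ m.+1 * v ^+ n.+1 =
  \sum_(0 <= i < m.+1) 'C(m - i + n, n)%:R * u ^+ i.+1 +
  \sum_(0 <= i < n.+1) 'C(n - i + m, m)%:R * v ^+ i.+1.
Proof.
pose S m n (x : A) := \sum_(0 <= i < m.+1) 'C(m - i + n, n)%:R * x ^+ i.+1.
have S0 p x : S 0%N p x = x.
  by rewrite /S big_nat1 subnn add0n binn mul1r.
have Sn0 p x : S p.+1 0%N x = x ^+ p.+2 + S p 0%N x.
  rewrite /S big_nat_recr//= bin0 mul1r addrC; congr (_ + _).
  by apply: eq_bigr => i _; rewrite !bin0.
have SS p r x : S p.+1 r.+1 x = S p.+1 r x + S p r.+1 x.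
  rewrite /S big_nat_recr//= [\sum_(0 <= i < p.+2) _]big_nat_recr//= subnn.
  rewrite !add0n !binn -addrA [_ + \sum_(_ <= _ < _) _]addrC addrA.
  congr (_ + _); rewrite -big_split/=; apply: eq_big_nat => i /andP[_ ip].
  have -> : (p.+1 - i + r.+1 = (p - i + r.+1).+1)%N by lia.
  have -> : (p.+1 - i + r = (p - i + r.+1))%N by lia.
  by rewrite binS natrD; ring.
move=> uv; rewrite -/(S m n u) -/(S n m v).
elim: m n => [|m IHm]; elim=> [|n IHn].
- by rewrite !S0 !expr1.
- rewrite S0 Sn0 expr1 (exprS v n.+1) mulrA -uv mulrDl -{1}(expr1 u) IHn S0.
  by rewrite -exprS; ring.
- rewrite S0 Sn0 expr1 (exprSr u m.+1) -mulrA -uv mulrDr -{1}(expr1 v) IHm S0.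
  by rewrite -exprSr; ring.
- rewrite !SS.
  have -> : u ^+ m.+2 * v ^+ n.+2 = u ^+ m.+2 * v ^+ n.+1 + u ^+ m.+1 * v ^+ n.+2.
     by rewrite !(exprS _ _.+1) mulrACA -uv; ring.
  by rewrite IHm IHn; ring.
Qed.

(** * Alternating sums *)

(** [hurwitz_zeta] is a [limn], meaningful only once convergence is known. The partial sums
    increase, and comparison with the telescoping series of 1 / ((m + a) (m + 1 + a)) bounds
    them. *)
Lemma hurwitz_zeta_cvg (R : realType) (j : nat) (a : R) : (1 < j)%N -> 0 < a ->
  (fun n => \sum_(0 <= m < n) (m%:R + a) ^- j) @ \oo --> hurwitz_zeta j a.
Proof.
move=> j1 a0.
have pos m : 0 < m%:R + a by rewrite ltr_wpDl.
have sumS n : \sum_(0 <= m < n.+1) (m%:R + a) ^- j <=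
    a ^- j + (a^-1 - (n%:R + a)^-1).
  elim: n => [|n IHn]; first by rewrite big_nat1 add0r subrr addr0.
  rewrite big_nat_recr//=.
  suff : (n.+1%:R + a) ^- j <= (n%:R + a)^-1 - (n.+1%:R + a)^-1.
    by move: IHn; lra.
  have -> : (n%:R + a)^-1 - (n.+1%:R + a)^-1 =
      ((n%:R + a) * (n.+1%:R + a))^-1.
    by rewrite -natr1; field; rewrite natr1 !gt_eqF.
  rewrite lef_pV2 ?posrE ?mulr_gt0 ?exprn_gt0//.
  (* A base of at least 1 allows the exponent [j] to be lowered to 2; this is why the first term
     [a ^- j] is kept apart in the bound. *)
  have x1 : 1 <= n.+1%:R + a by rewrite -natr1; have := pos n; lra.
  apply: (@le_trans _ _ ((n.+1%:R + a) ^+ 2)); last exact: ler_weXn2l.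
  by rewrite expr2 ler_pM2r// lerD2r ler_nat.
apply: nondecreasing_is_cvgn.
  move=> m n mn; rewrite [leRHS](big_cat_nat (n := m))//=.
  by rewrite lerDl sumr_ge0// => i _; rewrite invr_ge0 exprn_ge0// ltW.
exists (a ^- j + a^-1) => _ [n _ <-] /=.
apply: (@le_trans _ _ (\sum_(0 <= m < n.+1) (m%:R + a) ^- j)).
  by rewrite big_nat_recr//= lerDl invr_ge0 exprn_ge0// ltW.
apply: (le_trans (sumS n)); rewrite lerD2l gerBl invr_ge0 ltW//.
Qed.

Lemma big_nat_double (V : nmodType) (F : nat -> V) (n : nat) :
  \sum_(0 <= m < n.*2) F m = \sum_(0 <= m < n) (F m.*2 + F m.*2.+1).
Proof.
elim: n => [|n IHn]; first by rewrite !big_geq.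
by rewrite doubleS !big_nat_recr//= IHn addrA.
Qed.

Lemma big_nat_even (V : nmodType) (F : nat -> V) (n : nat) :
  \sum_(1 <= j < n.+1) (if odd j then 0 else F j) =
  \sum_(1 <= i < n./2.+1) F (i.*2).
Proof.
elim: n => [|n IHn]; first by rewrite !big_geq.
rewrite big_nat_recr//= IHn; case: (boolP (odd n)) => on; last first.
  by rewrite addr0 uphalf_half (negbTE on).
rewrite uphalf_half on add1n [RHS]big_nat_recr//=; congr (_ + F _).
by rewrite doubleS -[in LHS](odd_double_half n) on.
Qed.

(** Even and odd indices give 2 (m + a / 2) and 2 (m + (a + 1) / 2). An even number of terms leaves
    no unpaired one, which is why the later sums run up to [n.*2]. *)
Lemma alternating_hurwitz_sum (F : numFieldType) (j n : nat) (a : F) :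
  \sum_(0 <= m < n.*2) (-1) ^+ m * (m%:R + a) ^- j =
  2 ^- j * (\sum_(0 <= m < n) (m%:R + a / 2) ^- j -
            \sum_(0 <= m < n) (m%:R + (a + 1) / 2) ^- j).
Proof.
rewrite big_nat_double mulrBr !mulr_sumr -sumrB; apply: eq_big_nat => m _.
have sgnm : (-1) ^+ m.*2 = 1 :> F by rewrite -signr_odd odd_double.
rewrite exprS sgnm mulr1 mulN1r mul1r.
rewrite -!exprVn -!exprMn -!invfM; congr (_ ^+ _ - _ ^+ _); congr (_^-1).
  by rewrite -mul2n natrM; field.
by rewrite -natr1 -mul2n natrM; field.
Qed.
(** With t = pi / 6, the vanishing of cos (3 t) = cos t (4 cos^2 t - 3) forces cos^2 t = 3 / 4,
    hence tan^2 t = 1 / 3; signs are settled by t lying in the first quadrant. *)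
Lemma atan_invr_sqrt3 (R : realType) : atan (Num.sqrt 3)^-1 = pi / 6 :> R.
Proof.
have pi0 := pi_gt0 R.
pose t : R := pi / 6; rewrite -/t.
have tI : - (pi / 2) < t < pi / 2 by rewrite /t; lra.
have c0 : 0 < cos t by exact: cos_gt0_pihalf.
have s0 : 0 < sin t by apply: sin_gt0_pihalf; move: tI; rewrite /t; lra.
have cs := cos2Dsin2 t.
have c3 : cos (t + t *+ 2) = 0.
  by rewrite -[RHS](cos_pihalf R); congr cos; rewrite /t; lra.
have c2 : cos t ^+ 2 = 3 / 4.
  move: c3; rewrite cosD cos_mulr2n sin_mulr2n => c3.
  have : cos t * (4 * cos t ^+ 2 - 3) = 0.
    transitivity (2 * cos t * (cos t ^+ 2 + sin t ^+ 2 - 1)).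
      by apply/eqP; rewrite -subr_eq0 -c3; apply/eqP; ring.
    by rewrite cs subrr mulr0.
  by move/eqP; rewrite mulf_eq0 (gt_eqF c0)/= => /eqP; lra.
have s2 : sin t ^+ 2 = 1 / 4 by lra.
have tan0 : 0 <= tan t by rewrite /tan divr_ge0// ltW.
have -> : (Num.sqrt 3)^-1 = tan t.
  rewrite -[RHS](ger0_norm tan0) -sqrtr_sqr -sqrtrV//; congr Num.sqrt.
  by rewrite /tan expr_div_n c2 s2; field.
by rewrite tanK// in_itv.
Qed.

(* Both sides are the value at 1 of a primitive of [(1 + x) / (1 + x^3) = 1
   / (1 - x + x^2)]; the truncated geometric series errs by at most [4 / 3 x^(3
   n)] on [[0, 1]]. *)
Lemma alternating_mod3_sum (R : realType) :
  (fun n => \sum_(0 <= m < n) (-1) ^+ m *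
     ((3 * m + 1)%:R^-1 + (3 * m + 2)%:R^-1)) @ \oo -->
  (2 * pi / (3 * Num.sqrt 3) : R).
Proof.
set r := Num.sqrt 3 : R.
have r0 : 0 < r by rewrite sqrtr_gt0.
have r2 : r ^+ 2 = 3 by rewrite sqr_sqrtr.
pose p n : {poly R} := \sum_(0 <= m < n) (-1) ^+ m *:
  ((3 * m + 1)%:R^-1 *: 'X^(3 * m + 1) + (3 * m + 2)%:R^-1 *: 'X^(3 * m + 2)).
(* The derivative of [p n] is (1 + x) times a geometric sum of ratio - x^3, and (1 + x) (1 - x +
   x^2) = 1 + x^3. *)
have dp n x : (p n)^`().[x] * (1 - x + x ^+ 2) = 1 - (-1) ^+ n * x ^+ (3 * n).
  elim: n => [|n IHn].
    by rewrite /p big_geq// deriv0 horner0 mul0r muln0 !expr0 mulr1 subrr.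
  rewrite /p big_nat_recr//= -/(p n) derivD hornerD mulrDl IHn.
  have dX (c k : nat) : (c = k.+1)%N -> (c%:R^-1 *: 'X^c)^`().[x] = x ^+ k.
    move=> ->; rewrite derivZ derivXn hornerZ hornerMn hornerXn -(mulr_natl (x ^+ _)).
    by rewrite mulKf// pnatr_eq0.
  rewrite derivZ hornerZ derivD hornerD (dX _ (3 * n)%N) ?addn1//.
  rewrite (dX _ (3 * n).+1) ?addn2//.
  rewrite (_ : (3 * n.+1 = (3 * n).+3)%N); last lia.
  by rewrite !exprS; move: (x ^+ (3 * n)) => X; ring.
(* Completing the square, 1 - x + x^2 = 3 / 4 (1 + ((2 x - 1) / r)^2), gives this primitive of 1 /
   (1 - x + x^2). *)
pose at_ (x : R) : R := 2 / r * atan ((2 * x - 1) / r).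
have dat (x : R) : is_derive x 1 at_ (1 - x + x ^+ 2)^-1.
  have d1 : is_derive x 1 (fun y : R => (2 * y - 1) / r) (2 / r).
    have -> : (fun y : R => (2 * y - 1) / r) = horner ((2 / r) *: 'X - (1 / r)%:P).
      by apply/funext => y; rewrite !hornerE; ring.
    by apply: is_derive_eq; rewrite derivB derivZ derivX derivC subr0 !hornerE.
  have d2 := @is_derive1_comp R atan (fun y : R => (2 * y - 1) / r) x _ _
    (is_derive1_atan _) d1.
  apply: (is_derive_eq (is_deriveZ (2 / r) d2)).
  rewrite /GRing.scale/=.
  have q0 : 0 < 1 - x + x ^+ 2 by have := sqr_ge0 (x - 1 / 2); lra.
  have -> : 1 + ((2 * x - 1) / r) ^+ 2 = 4 / 3 * (1 - x + x ^+ 2).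
    by rewrite expr_div_n r2; field.
  transitivity (4 / r ^+ 2 * (4 / 3 * (1 - x + x ^+ 2))^-1).
    by field; rewrite !lt0r_neq0// mulr_gt0.
  by rewrite r2; field; rewrite lt0r_neq0.
have at01 : at_ 1 - at_ 0 = 2 * pi / (3 * r).
  rewrite /at_ mulr1 mulr0 sub0r mulN1r atanN (_ : 2 - 1 = 1 :> R); last lra.
  rewrite mul1r atan_invr_sqrt3; field; exact: lt0r_neq0.
(* This is the integral of 4 / 3 x^(3 n) over [0, 1]; the factor 4 / 3 comes from 1 - x + x^2 >= 3 /
   4. *)
pose c n : R := 4 / 3 * (3 * n + 1)%:R^-1.
have bound n (e : R) : `|e| = 1 ->
    0 <= e * ((p n).[1] - (p n).[0] - (at_ 1 - at_ 0)) + c n.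
  (* Adding [c n *: 'X^(3 * n + 1)], with derivative 4 / 3 x^(3 n), makes the derivative of [H]
     nonnegative on [0, 1], so the mean value theorem gives H 1 >= H 0. Taking [e] to be 1 and -1
     yields both sides of the estimate. *)
  move=> e1; pose P := e *: p n + c n *: 'X^(3 * n + 1).
  pose H x := P.[x] - e * at_ x.
  have dH (x : R) : is_derive x 1 H (P^`().[x] - e * (1 - x + x ^+ 2)^-1).
    exact: (is_deriveB (is_derive_poly P x) (is_deriveZ e (dat x))).
  have [x x01] := @MVT_segment _ H _ 0 1 ler01 (fun x _ => dH x)
    (derivable_within_continuous (fun x _ => @ex_derive _ _ _ _ _ _ _ (dH x))).
  have x0 : 0 <= x by move: x01; rewrite in_itv/= => /andP[].
  have P1 : P.[1] = e * (p n).[1] + c n by rewrite /P !hornerE expr1n mulr1.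
  have P0 : P.[0] = e * (p n).[0].
    by rewrite /P !hornerE addn1 expr0n/= mulr0 addr0.
  rewrite subr0 mulr1 {1 2}/H P1 P0 => HE.
  have -> : e * ((p n).[1] - (p n).[0] - (at_ 1 - at_ 0)) + c n =
    e * (p n).[1] + c n - e * at_ 1 - (e * (p n).[0] - e * at_ 0) by ring.
  rewrite HE /P derivD !derivZ derivXn hornerD !hornerZ hornerMn hornerXn/=.
  have q0 : 3 / 4 <= 1 - x + x ^+ 2 by have := sqr_ge0 (x - 1 / 2); lra.
  have -> : (p n)^`().[x] = (1 - (-1) ^+ n * x ^+ (3 * n)) / (1 - x + x ^+ 2).
    by rewrite -dp mulfK// lt0r_neq0//; lra.
  have -> : c n * (x ^+ (3 * n + 1).-1 *+ (3 * n + 1)) = 4 / 3 * x ^+ (3 * n).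
    by rewrite -(mulr_natl (x ^+ _)) /c addn1 -[LHS]mulrA mulKf// pnatr_eq0.
  have X0 : 0 <= x ^+ (3 * n) by rewrite exprn_ge0.
  have : `|e * ((-1) ^+ n * x ^+ (3 * n) / (1 - x + x ^+ 2))| <= 4 / 3 * x ^+ (3 * n).
    rewrite normrM e1 mul1r !normrM normrX normrN1 expr1n mul1r ger0_norm//.
    rewrite normfV ger0_norm; last lra.
    rewrite mulrC ler_wpM2r// -[leRHS]invrK lef_pV2 ?posrE; lra.
  rewrite ler_norml => /andP[_]; rewrite mulrBl !mulrBr; lra.
have Sn n : \sum_(0 <= m < n) (-1) ^+ m *
     ((3 * m + 1)%:R^-1 + (3 * m + 2)%:R^-1) = (p n).[1] - (p n).[0] :> R.
  rewrite /p !horner_sum -sumrB; apply: eq_bigr => m _.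
  by rewrite !hornerE !expr1n !addnS !expr0n/= !mulr1 !mulr0 addr0 mulr0 subr0.
rewrite -at01; apply/cvgrPdist_le => /= e e0; near=> n; rewrite Sn.
have cn : c n <= e.
  have : n.+1%:R^-1 < e / 2.
    near: n.
    exact: (near_infty_natSinv_lt (PosNum (divr_gt0 e0 (ltr0n R 2)))).
  have : (3 * n + 1)%:R^-1 <= n.+1%:R^-1 :> R.
    by rewrite lef_pV2 ?posrE ?ltr0n ?addn1// ler_nat ltnS leq_pmull.
  rewrite /c; move: (_^-1) (_^-1) => a b; lra.
have := bound n 1 (normr1 _); have := bound n (-1); rewrite normrN1 => /(_ erefl).
by rewrite ler_norml; lra.
Unshelve. all: by end_near. Qed.

Lemma cvg_double (T : topologicalType) (u : nat -> T) (l : T) :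
  u @ \oo --> l -> (fun n => u n.*2) @ \oo --> l.
Proof.
move=> ul; under eq_fun do rewrite -mul2n.
by apply: (@cvg_comp _ _ _ (muln 2) u _ _ _ _ ul); apply: cvg_mulnl.
Qed.

Lemma alternating_hurwitz_cvg (R : realType) (j : nat) (a : R) :
  (1 < j)%N -> 0 < a ->
  (fun n => \sum_(0 <= m < n.*2) (-1) ^+ m * (m%:R + a) ^- j) @ \oo -->
  2 ^- j * (hurwitz_zeta j (a / 2) - hurwitz_zeta j ((a + 1) / 2)).
Proof.
move=> j1 a0; under eq_fun do rewrite alternating_hurwitz_sum.
by apply: cvgMr; apply: cvgB; apply: hurwitz_zeta_cvg => //; lra.
Qed.

(** Serves to reduce the parameter 7 / 6 = 1 / 6 + 1; the dropped term (1 / 6)^(-j) is the source of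
    the summand 6^j in the final formula. *)
Lemma hurwitz_zeta_succ (R : realType) (j : nat) (a : R) :
  (1 < j)%N -> 0 < a -> hurwitz_zeta j (a + 1) = hurwitz_zeta j a - a ^- j.
Proof.
move=> j1 a0; apply: cvg_lim => //.
have -> : (fun n => \sum_(0 <= m < n) (m%:R + (a + 1)) ^- j) =
    (fun n => \sum_(0 <= m < n.+1) (m%:R + a) ^- j - a ^- j) :> (nat -> R).
  apply/funext => n; rewrite big_nat_recl//= add0r addrAC subrr add0r.
  by apply: eq_bigr => m _; rewrite addrCA addrC -natr1 -addrA.
apply: cvgB; last exact: cvg_cst.
by rewrite (cvg_shiftS (fun n => \sum_(0 <= m < n) (m%:R + a) ^- j)); exact: hurwitz_zeta_cvg.
Qed.

(** Dirichlet's eta function: the alternating sum is the full sum minus twice its terms with even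
    base, and those are 2^(-j) times a shorter full sum. *)
Lemma eta_cvg (R : realType) (j : nat) : (1 < j)%N ->
  (fun n => \sum_(0 <= m < n.*2) (-1) ^+ m * m.+1%:R ^- j) @ \oo -->
  ((1 - 2 * 2 ^- j) * riemann_zeta j : R).
Proof.
move=> j1.
have zc : (fun n => \sum_(0 <= m < n) m.+1%:R ^- j) @ \oo --> (riemann_zeta j : R).
  under eq_fun do under eq_bigr do rewrite -natr1.
  exact: hurwitz_zeta_cvg.
have -> : (fun n => \sum_(0 <= m < n.*2) (-1) ^+ m * m.+1%:R ^- j) =
   (fun n => \sum_(0 <= m < n.*2) m.+1%:R ^- j -
     2 * 2 ^- j * \sum_(0 <= m < n) m.+1%:R ^- j) :> (nat -> R).
  apply/funext => n; rewrite !big_nat_double mulr_sumr -sumrB.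
  apply: eq_big_nat => m _; rewrite exprS -signr_odd odd_double mulr1 mul1r.
  rewrite (_ : m.*2.+2 = 2 * m.+1)%N ?natrM; last by rewrite -doubleS mul2n.
  rewrite exprMn invfM; ring.
rewrite mulrBl mul1r; apply: cvgB; first exact: cvg_double zc.
by apply: cvgMr.
Qed.

(** With s = m + 1, the terms in 3 s and - 3 s cancel for odd [j] and double for even [j], leaving
    an eta value. The other two are alternating Hurwitz sums, as 1 - 3 s = - 3 (m + 2 / 3) and 1 + 3
    s = 3 (m + 4 / 3). *)
Lemma pentagonal_component_cvg (R : realType) (j : nat) : (1 < j)%N ->
  (fun n => \sum_(0 <= m < n.*2) (-1) ^+ m *
     ((3 * m.+1%:R) ^- j + (- (3 * m.+1%:R)) ^- j +
      ((1 - 3 * m.+1%:R) ^- j + (1 + 3 * m.+1%:R) ^- j))) @ \oo -->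
  ((if odd j then 0 else 2 * 3 ^- j * (1 - 2 * 2 ^- j) * riemann_zeta j) +
  6 ^- j * ((-1) ^+ j * (hurwitz_zeta j (1 / 3) - hurwitz_zeta j (5 / 6)) +
    hurwitz_zeta j (2 / 3) - hurwitz_zeta j (1 / 6) + 6 ^+ j) : R).
Proof.
move=> j1.
have a23 : 0 < 2 / 3 :> R by lra.
have a43 : 0 < 4 / 3 :> R by lra.
have e0 := eta_cvg R _ j1.
have e1 := @alternating_hurwitz_cvg R _ _ j1 a23.
have e2 := @alternating_hurwitz_cvg R _ _ j1 a43.
pose E n : R := \sum_(0 <= m < n.*2) (-1) ^+ m * m.+1%:R ^- j.
pose S n (a : R) := \sum_(0 <= m < n.*2) (-1) ^+ m * (m%:R + a) ^- j.
have -> : (fun n => \sum_(0 <= m < n.*2) (-1) ^+ m *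
     ((3 * m.+1%:R) ^- j + (- (3 * m.+1%:R)) ^- j +
      ((1 - 3 * m.+1%:R) ^- j + (1 + 3 * m.+1%:R) ^- j))) =
  (fun n => (1 + (-1) ^+ j) * 3 ^- j * E n +
    ((-1) ^+ j * 3 ^- j * S n (2 / 3) + 3 ^- j * S n (4 / 3))) :> (nat -> R).
  apply/funext => n; rewrite /E /S !mulr_sumr -!big_split/=.
  apply: eq_bigr => m _.
  have -> : 1 - 3 * m.+1%:R = -1 * (3 * (m%:R + 2 / 3)) :> R.
    by rewrite -natr1; field.
  have -> : 1 + 3 * m.+1%:R = 3 * (m%:R + 4 / 3) :> R.
    by rewrite -natr1; field.
  have -> : - (3 * m.+1%:R) = -1 * (3 * m.+1%:R) :> R by ring.
  rewrite !exprMn !invfM invr_sign; ring.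
have -> : (if odd j then 0 else 2 * 3 ^- j * (1 - 2 * 2 ^- j) * riemann_zeta j) =
    (1 + (-1) ^+ j) * 3 ^- j * ((1 - 2 * 2 ^- j) * riemann_zeta j) :> R.
  rewrite -signr_odd; case: odd; first by rewrite expr1 subrr !mul0r.
  rewrite expr0; ring.
have -> : 6 ^- j * ((-1) ^+ j * (hurwitz_zeta j (1 / 3) - hurwitz_zeta j (5 / 6)) +
    hurwitz_zeta j (2 / 3) - hurwitz_zeta j (1 / 6) + 6 ^+ j) =
  (-1) ^+ j * 3 ^- j * (2 ^- j * (hurwitz_zeta j ((2 / 3) / 2) -
      hurwitz_zeta j ((2 / 3 + 1) / 2))) +
  3 ^- j * (2 ^- j * (hurwitz_zeta j ((4 / 3) / 2) -
      hurwitz_zeta j ((4 / 3 + 1) / 2))) :> R.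
  rewrite (_ : 2 / 3 / 2 = 1 / 3); last by field.
  rewrite (_ : (2 / 3 + 1) / 2 = 5 / 6); last by field.
  rewrite (_ : 4 / 3 / 2 = 2 / 3); last by field.
  rewrite (_ : (4 / 3 + 1) / 2 = 1 / 6 + 1); last by field.
  rewrite hurwitz_zeta_succ//.
  rewrite (_ : 6 = 3 * 2 :> R); last by ring.
  rewrite !mul1r !exprVn invrK invfM exprMn; field.
  by rewrite !expf_neq0.
by apply: cvgD; [exact: cvgMr|apply: cvgD; exact: cvgMr].
Qed.

Lemma pentagonal_component1_cvg (R : realType) :
  (fun n => \sum_(0 <= m < n.*2) (-1) ^+ m *
     ((3 * m.+1%:R) ^- 1 + (- (3 * m.+1%:R)) ^- 1 +
      ((1 - 3 * m.+1%:R) ^- 1 + (1 + 3 * m.+1%:R) ^- 1))) @ \oo -->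
  (1 - 2 * pi / (3 * Num.sqrt 3) : R).
Proof.
pose S n : R := \sum_(0 <= m < n) (-1) ^+ m *
     ((3 * m + 1)%:R^-1 + (3 * m + 2)%:R^-1).
(* The terms in 3 s and - 3 s cancel. Since 1 / (3 m + 4) is 1 / (3 (m + 1) + 1) with the opposite
   sign, an index shift produces [S n], the leading 1 and a vanishing boundary term. *)
have e n : \sum_(0 <= m < n) (-1) ^+ m *
     ((3 * m.+1%:R) ^- 1 + (- (3 * m.+1%:R)) ^- 1 +
      ((1 - 3 * m.+1%:R) ^- 1 + (1 + 3 * m.+1%:R) ^- 1)) =
     1 - S n - (-1) ^+ n * (3 * n + 1)%:R^-1 :> R.
  elim: n => [|n IHn].
    by rewrite /S !big_geq// muln0 expr0 invr1 subr0 mulr1 subrr.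
  rewrite big_nat_recr//= IHn /S [in RHS]big_nat_recr//= -/(S n) !expr1.
  have -> : 1 - 3 * n.+1%:R = - (3 * n + 2)%:R :> R.
    by rewrite natrD natrM -natr1; ring.
  have -> : 1 + 3 * n.+1%:R = (3 * n.+1 + 1)%:R :> R.
    by rewrite natrD natrM; ring.
  rewrite !invrN exprS; ring.
under eq_fun do rewrite e -signr_odd odd_double mul1r.
rewrite -(subr0 (1 - _)); apply: cvgB; first apply: cvgB.
- exact: cvg_cst.
- by apply: cvg_double; exact: alternating_mod3_sum.
- apply: (cvg_double R (fun n => (3 * n + 1)%:R^-1 : R)).
  apply: (@squeeze_cvgr _ _ _ _ (fun=> 0) (@harmonic R)).
  + near=> n; rewrite invr_ge0 ler0n/= lef_pV2 ?posrE ?ltr0n ?addn1//.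
    by rewrite ler_nat ltnS leq_pmull.
  + exact: cvg_cst.
  + exact: cvg_harmonic.
Unshelve. all: by end_near. Qed.

(** * Closed form of the pentagonal series *)

Lemma bin2_natrE (F : numFieldType) (n : nat) :
  'C(n.+1, 2)%:R = n%:R * n.+1%:R / 2 :> F.
Proof.
have : ('C(n.+1, 2) * 2 = n * n.+1)%N by rewrite bin_ffact ffactnS ffactn1 mulnC.
by move=> /(congr1 (fun m => m%:R : F)); rewrite !natrM => <-; field.
Qed.

(** For s = m + 1 and x = 3 s, the two pentagonal numbers are - x (1 - x) / 6 and the same
    expression at - x, so [partial_fractions] applies at both points with equal exponents. *)
Lemma pentagonal_term_expand (F : numFieldType) (K m : nat) :
  (m.+1 ^ 2 + 'C(m.+1, 2))%:R ^- K.+1 + (m.+1 ^ 2 + 'C(m.+2, 2))%:R ^- K.+1 =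
  (- 6) ^+ K.+1 * \sum_(0 <= i < K.+1) 'C(K - i + K, K)%:R *
     ((3 * m.+1%:R) ^- i.+1 + (- (3 * m.+1%:R)) ^- i.+1 +
      ((1 - 3 * m.+1%:R) ^- i.+1 + (1 + 3 * m.+1%:R) ^- i.+1)) :> F.
Proof.
have m0 : m.+1%:R != 0 :> F by rewrite pnatr_eq0.
have d1 : 1 - 3 * m.+1%:R != 0 :> F.
  have -> : 1 - 3 * m.+1%:R = - (3 * m + 2)%:R :> F.
    by rewrite natrD natrM -natr1; ring.
  by rewrite oppr_eq0 pnatr_eq0 addn2.
have d2 : 1 + 3 * m.+1%:R != 0 :> F by rewrite -natrM nat1r pnatr_eq0.
have exp (x : F) : x != 0 -> 1 - x != 0 ->
    (x * (1 - x))^-1 ^+ K.+1 = \sum_(0 <= i < K.+1) 'C(K - i + K, K)%:R *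
     (x ^- i.+1 + (1 - x) ^- i.+1).
  move=> x0 x1; rewrite invfM exprMn partial_fractions; last by field; rewrite x0 x1.
  by rewrite -big_split/=; apply: eq_bigr => i _; rewrite !exprVn mulrDr.
pose x : F := 3 * m.+1%:R.
have x0 : x != 0 by rewrite mulf_neq0// pnatr_eq0.
have -> : (m.+1 ^ 2 + 'C(m.+1, 2))%:R ^- K.+1 =
    (- 6) ^+ K.+1 * (x * (1 - x))^-1 ^+ K.+1.
  rewrite -exprVn -exprMn natrD natrX bin2_natrE; congr (_ ^+ _).
  have -> : m%:R = m.+1%:R - 1 :> F by rewrite -natr1 addrK.
  have -> : m.+1%:R ^+ 2 + (m.+1%:R - 1) * m.+1%:R / 2 = - (x * (1 - x)) / 6.
    by rewrite /x; field.
  by field; rewrite x0 d1.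
have -> : (m.+1 ^ 2 + 'C(m.+2, 2))%:R ^- K.+1 =
    (- 6) ^+ K.+1 * (- x * (1 - - x))^-1 ^+ K.+1.
  rewrite -exprVn -exprMn natrD natrX bin2_natrE; congr (_ ^+ _).
  have -> : m.+2%:R = m.+1%:R + 1 :> F by rewrite natr1.
  have -> : m.+1%:R ^+ 2 + m.+1%:R * (m.+1%:R + 1) / 2 = - (- x * (1 - - x)) / 6.
    by rewrite /x; field.
  by field; rewrite opprK x0 d2.
rewrite !exp ?oppr_eq0 ?opprK// -mulrDr -big_split/=; congr (_ * _).
by apply: eq_bigr => i _; rewrite /x; ring.
Qed.

Lemma pentagonal_series_cvg (R : realType) (k : nat) : (0 < k)%N ->
  (fun n => \sum_(0 <= m < n.*2) (-1) ^+ m *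
     ((m.+1 ^ 2 + 'C(m.+1, 2))%:R ^- k + (m.+1 ^ 2 + 'C(m.+2, 2))%:R ^- k)) @ \oo -->
  ((-1) ^+ k *
    ( - (6 ^+ k * (2 * pi / (3 * Num.sqrt 3) - 1) * 'C(2 * k - 2, k - 1)%:R)
      + \sum_(1 <= j < k./2.+1)
          (2 ^+ k.+1 * 'C(2 * k - 2 * j - 1, k - 1)%:R * 3 ^+ (k - 2 * j)
           * riemann_zeta (2 * j) * (1 - (2 ^+ (2 * j - 1))^-1))
      + \sum_(2 <= j < k.+1)
          ('C(2 * k - j - 1, k - 1)%:R * 6 ^+ (k - j) *
           ((-1) ^+ j * (hurwitz_zeta j (1 / 3) - hurwitz_zeta j (5 / 6))
            + hurwitz_zeta j (2 / 3) - hurwitz_zeta j (1 / 6) + 6 ^+ j))) : R).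
Proof.
case: k => // K _.
pose T i n : R := \sum_(0 <= m < n.*2) (-1) ^+ m *
     ((3 * m.+1%:R) ^- i.+1 + (- (3 * m.+1%:R)) ^- i.+1 +
      ((1 - 3 * m.+1%:R) ^- i.+1 + (1 + 3 * m.+1%:R) ^- i.+1)).
pose e j : R := if (j == 1%N) then 0 else
  2 * 3 ^- j * (1 - 2 * 2 ^- j) * riemann_zeta j.
(* At j = 1 the zeta series diverge, so the arctangent value is carried separately. *)
pose g j : R := if (j == 1%N) then 1 - 2 * pi / (3 * Num.sqrt 3) else
  6 ^- j * ((-1) ^+ j * (hurwitz_zeta j (1 / 3) - hurwitz_zeta j (5 / 6)) +
    hurwitz_zeta j (2 / 3) - hurwitz_zeta j (1 / 6) + 6 ^+ j).
have Tcvg i : T i @ \oo --> (if odd i.+1 then 0 else e i.+1) + g i.+1.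
  case: i => [|i]; first by rewrite add0r; exact: pentagonal_component1_cvg.
  exact: pentagonal_component_cvg.
have -> : (fun n => \sum_(0 <= m < n.*2) (-1) ^+ m *
     ((m.+1 ^ 2 + 'C(m.+1, 2))%:R ^- K.+1 + (m.+1 ^ 2 + 'C(m.+2, 2))%:R ^- K.+1)) =
   (fun n => (- 6) ^+ K.+1 * \sum_(0 <= i < K.+1) 'C(K - i + K, K)%:R * T i n)
   :> (nat -> R).
  apply/funext => n; under eq_bigr do rewrite pentagonal_term_expand mulrCA.
  rewrite -mulr_sumr; congr (_ * _).
  under eq_bigr do rewrite mulr_sumr.
  rewrite exchange_big/=; apply: eq_bigr => i _; rewrite mulr_sumr.
  by apply: eq_bigr => m _; rewrite mulrCA.
have -> :  (-1) ^+ K.+1 *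
    ( - (6 ^+ K.+1 * (2 * pi / (3 * Num.sqrt 3) - 1) * 'C(2 * K.+1 - 2, K.+1 - 1)%:R)
      + \sum_(1 <= j < K.+1./2.+1)
          (2 ^+ K.+2 * 'C(2 * K.+1 - 2 * j - 1, K.+1 - 1)%:R * 3 ^+ (K.+1 - 2 * j)
           * riemann_zeta (2 * j) * (1 - (2 ^+ (2 * j - 1))^-1))
      + \sum_(2 <= j < K.+2)
          ('C(2 * K.+1 - j - 1, K.+1 - 1)%:R * 6 ^+ (K.+1 - j) *
           ((-1) ^+ j * (hurwitz_zeta j (1 / 3) - hurwitz_zeta j (5 / 6))
            + hurwitz_zeta j (2 / 3) - hurwitz_zeta j (1 / 6) + 6 ^+ j))) =
  (- 6) ^+ K.+1 * \sum_(0 <= i < K.+1) 'C(K - i + K, K)%:R *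
     ((if odd i.+1 then 0 else e i.+1) + g i.+1).
  rewrite (exprNn 6) -[RHS]mulrA; congr (_ * _).
  (* Reindexing by j = i + 1 turns the upper binomial index K - i + K into 2 (K + 1) - j - 1. *)
  transitivity (6 ^+ K.+1 * \sum_(1 <= j < K.+2) 'C(2 * K.+1 - j - 1, K)%:R *
      ((if odd j then 0 else e j) + g j)); last first.
    rewrite big_add1/=; congr (_ * _); apply: eq_big_nat => i /andP[_ iK].
    by congr ('C(_, _)%:R * _); lia.
  under [in RHS]eq_bigr do rewrite mulrDr.
  rewrite big_split/= [RHS]mulrDr.
  have -> : \sum_(1 <= j < K.+2) 'C(2 * K.+1 - j - 1, K)%:R * (if odd j then 0 else e j) =
     \sum_(1 <= i < K.+1./2.+1) 'C(2 * K.+1 - i.*2 - 1, K)%:R * e i.*2.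
    rewrite -(big_nat_even R (fun j => 'C(2 * K.+1 - j - 1, K)%:R * e j)).
    apply: eq_bigr => j _; case: odd => //.
    by rewrite mulr0.
  rewrite [X in _ = _ + X](_ : _ = 6 ^+ K.+1 * ('C(2 * K.+1 - 1 - 1, K)%:R * g 1) +
    6 ^+ K.+1 * \sum_(2 <= j < K.+2) 'C(2 * K.+1 - j - 1, K)%:R * g j); last first.
    by rewrite big_ltn// mulrDr.
  rewrite [RHS]addrCA [in RHS]addrA -!addrA.
  rewrite (subn1 K.+1)/=; congr (_ + (_ + _)).
  - rewrite {1}/g eqxx -subnDA.
    by ring.
  - rewrite mulr_sumr; apply: eq_big_nat => i /andP[i0 iK].
    rewrite /e (_ : i.*2 == 1%N = false); last by lia.
    rewrite -mul2n.
    have iK2 : (2 * i <= K.+1)%N by lia.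
    (* The factor 3^(2 i) cancels the one in [e]; the leading 2 of [e] raises 2^(K+1) to 2^(K+2). *)
    rewrite (_ : 6 ^+ K.+1 = 2 ^+ K.+1 * (3 ^+ (K.+1 - 2 * i) * 3 ^+ (2 * i))); last first.
      by rewrite -exprD subnK// -exprMn; congr (_ ^+ _); ring.
    have -> : 2 ^+ (2 * i) = 2 * 2 ^+ (2 * i - 1) :> R.
      by rewrite subn1 -exprS prednK// muln_gt0.
    rewrite exprS; field.
    by rewrite !expf_neq0.
  - rewrite mulr_sumr; apply: eq_big_nat => i /andP[i1 iK].
    rewrite /g gtn_eqF//.
    rewrite (_ : 6 ^+ K.+1 = 6 ^+ (K.+1 - i) * 6 ^+ i); last by rewrite -exprD subnK.
    by rewrite [RHS]mulrCA -!mulrA mulVKf ?expf_neq0.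
apply: cvgMr.
apply: cvg_big => [|i _]; first exact: add_continuous.
apply: cvgMr; exact: Tcvg.
Qed.

(** * Moments and tails *)

(** One term of the exponential series gives e^(c t) >= (c t)^(i+1) / (i+1)!, so the product is at
    most [M] / t. *)
Lemma exprn_expRN_cvg0 (R : realType) (c : R) (i : nat) : 0 < c ->
  t ^+ i * expR (- (c * t)) @[t --> +oo] --> (0 : R).
Proof.
move=> c0; pose M : R := i.+1`!%:R / c ^+ i.+1.
apply: (@squeeze_cvgr _ _ _ _ (fun=> 0) (fun t => M * t^-1)).
- near=> t; have t0 : 0 < t by near: t; exact: nbhs_pinfty_gt.
  rewrite mulr_ge0 ?exprn_ge0 ?expR_ge0 ?(ltW t0)//=.
  rewrite expRN ler_pdivrMr ?expR_gt0//.
  have ct0 : 0 <= c * t by rewrite mulr_ge0 ?ltW.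
  have := expR_ge1Dxn i ct0; set e := expR _ => e1.
  have {}e1 : (c * t) ^+ i.+1 / i.+1`!%:R <= e by apply: le_trans e1; rewrite lerDr.
  have -> : t ^+ i = M * t^-1 * ((c * t) ^+ i.+1 / i.+1`!%:R).
    rewrite /M exprMn (exprS t); field.
    by rewrite pnatr_eq0 -lt0n fact_gt0 !gt_eqF ?exprn_gt0.
  by rewrite ler_wpM2l// /M mulr_ge0 ?invr_ge0 ?divr_ge0 ?exprn_ge0 ?ltW.
- exact: cvg_cst.
- rewrite -(mulr0 M); apply: cvgMr.
  apply: ((gtr0_cvgV0 _ (f := @id R)).2 _) => //; exact: nbhs_pinfty_gt.
Unshelve. all: by end_near. Qed.

(** Gamma integral. If c p - p' = X^K, then - p(t) e^(- c t) is a primitive vanishing at infinity,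
    so the integral equals p(0). *)
Lemma integral_exprn_expRN (R : realType) (K : nat) (c : R) : 0 < c ->
  (\int[lebesgue_measure]_(t in `[0%R, +oo[) (t ^+ K * expR (- (c * t)))%:E =
   (K`!%:R / c ^+ K.+1)%:E)%E.
Proof.
move=> c0.
have [p pX p0] : exists2 p : {poly R}, c *: p - p^`() = 'X^K &
    p.[0] = K`!%:R / c ^+ K.+1.
  elim: K => [|K [p pX p0]].
    exists (c^-1)%:P; last by rewrite hornerC fact0 mul1r.
    by rewrite derivC subr0 -mul_polyC -polyCM divff ?gt_eqF// expr0.
  (* Solves the equation for K + 1 from the solution for K; this is integration by parts at the
     level of polynomials. *)
  exists (c^-1 *: ('X^(K.+1) + K.+1%:R *: p)); last first.
    rewrite !hornerE p0 expr0n/= add0r factS natrM (exprSr c K.+1); field.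
    by rewrite ?gt_eqF ?exprn_gt0.
  rewrite scalerA divff ?gt_eqF// scale1r derivZ derivD derivXn derivZ/=.
  rewrite -pX -(scaler_nat _ (c *: p - p^`())) -scalerDr subrK !scalerA.
  by rewrite mulrAC mulVf ?gt_eqF// mul1r addrK.
have cE : continuous (fun t : R => expR (- (c * t))).
  move=> t; apply: continuous_comp; last exact: continuous_expR.
  by apply: continuousN; apply: cvgMr.
pose F t := - (p.[t] * expR (- (c * t))).
have dF (t : R) : is_derive t 1 F (t ^+ K * expR (- (c * t))).
  have d1 : is_derive t 1 (fun s : R => - (c * s)) (- c).
    have -> : (fun s : R => - (c * s)) = horner ((- c) *: 'X).
      by apply/funext => y; rewrite !hornerE; ring.
    by apply: is_derive_eq; rewrite derivZ derivX !hornerE.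
  have d2 := @is_derive1_comp R expR _ t _ _ (is_derive_expR _) d1.
  apply: (is_derive_eq (is_deriveN (is_deriveM (is_derive_poly p t) d2))).
  rewrite -[t ^+ K]hornerXn -pX hornerD hornerN hornerZ.
  by rewrite -![_ *: _]/(_ * _) /comp; ring.
have cF : continuous F.
  by move=> t; apply: differentiable_continuous; apply/derivable1_diffP.
rewrite (@ge0_continuous_FTC2y R _ F 0 0).
- by rewrite /F mulr0 oppr0 expR0 mulr1 p0 -EFinN opprK add0e.
- by move=> t t0; rewrite mulr_ge0 ?exprn_ge0 ?expR_ge0.
- apply: continuous_subspaceT => t; apply: cvgM; last exact: cE.
  exact: exprn_continuous.
- rewrite -oppr0; apply: cvgN.
  have -> : (fun t => p.[t] * expR (- (c * t))) =
      (fun t => \sum_(i < size p) p`_i * (t ^+ i * expR (- (c * t)))).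
    apply/funext => t; rewrite horner_coef mulr_suml.
    by apply: eq_bigr => i _; rewrite mulrA.
  have c0' : \sum_(i < size p) p`_i * (t ^+ i * expR (- (c * t))) @[t --> +oo] -->
      \sum_(i < size p) p`_i * 0.
    apply: cvg_big => [|i _]; first exact: add_continuous.
    by apply: cvgMr; exact: exprn_expRN_cvg0.
  by move: c0'; rewrite [X in _ --> X -> _]big1// => i _; rewrite mulr0.
- by move=> t _; exact: ex_derive.
- by apply: cvg_at_right_filter; exact: cF.
- by move=> t _; rewrite derive1E derive_val.
Qed.

Lemma integral_exprn_itv0o (R : realType) (K : nat) (y : R) : 0 <= y ->
  (\int[lebesgue_measure]_(t in `[0%R, y[) (K.+1%:R * t ^+ K)%:E =
   (y ^+ K.+1)%:E)%E.
Proof.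
rewrite le_eqVlt => /predU1P[<-|y0].
  by rewrite set_itvco0 integral_set0 expr0n.
have cf : continuous (fun t : R => K.+1%:R * t ^+ K).
  by move=> t; apply: cvgMr; exact: exprn_continuous.
have dF (t : R) : is_derive t 1 (fun t : R => t ^+ K.+1) (K.+1%:R * t ^+ K).
  have -> : (fun t : R => t ^+ K.+1) = horner 'X^(K.+1).
    by apply/funext => s; rewrite hornerXn.
  apply: (is_derive_eq (is_derive_poly 'X^(K.+1) t)).
  by rewrite derivXn hornerMn hornerXn mulr_natl.
have cF : continuous (fun t : R => t ^+ K.+1) by exact: exprn_continuous.
rewrite integral_itv_bndo_bndc; last first.
  apply/measurable_EFinP/measurable_funTS.
  exact: continuous_measurable_fun.
rewrite (@continuous_FTC2 R _ (fun t => t ^+ K.+1))//.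
- by rewrite expr0n sube0.
- exact: continuous_subspaceT.
- split.
  + by move=> t _; exact: ex_derive.
  + by apply: cvg_at_right_filter; exact: cF.
  + by apply: cvg_at_left_filter; exact: cF.
- by move=> t _; rewrite derive1E derive_val.
Qed.

(** Layer-cake formula: Y^(K+1) is the integral of (K+1) t^K over [0, Y[, and Tonelli exchanges the
    two integrals over the region [A] under the graph of [Y]. *)
Lemma integral_exprn_tail (R : realType) (d : measure_display)
    (T : measurableType d) (P : {finite_measure set T -> \bar R})
    (Y : T -> R) (K : nat) :
  measurable_fun [set: T] Y -> (forall w, 0 <= Y w) ->
  (\int[P]_w (Y w ^+ K.+1)%:E =
   \int[lebesgue_measure]_(t in `[0%R, +oo[)
     ((K.+1%:R * t ^+ K)%:E * P [set w | t < Y w]%R))%E.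
Proof.
move=> mY Y0; pose g (t : R) := K.+1%:R * t ^+ K.
have mg : measurable_fun [set: R] g.
  by apply: continuous_measurable_fun => t; apply: cvgMr; exact: exprn_continuous.
pose A : set (T * R) := [set p | (0 <= p.2) && (p.2 < Y p.1)].
pose f (p : T * R) : \bar R := ((EFin \o g \o snd) \_ A) p.
have mA : measurable A.
  rewrite (_ : A = [set p | 0 <= p.2] `&` [set p | p.2 < Y p.1]); last first.
    by apply/seteqP; split => p /andP.
  apply: measurableI.
  - have : measurable_fun [set: T * R] (fun p => 0 <= p.2).
      by apply: measurable_fun_ler => //; exact: measurable_snd.
    by move=> /(_ measurableT [set true]); rewrite setTI; exact.
  - have : measurable_fun [set: T * R] (fun p => p.2 < Y p.1).
      apply: measurable_fun_ltr => //.
      by apply: measurableT_comp => //.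
    by move=> /(_ measurableT [set true]); rewrite setTI; exact.
have mf : measurable_fun [set: T * R] f.
  apply/(measurable_restrictT _ mA)/measurable_funTS.
  by apply: measurableT_comp => //; apply: measurableT_comp.
have f0 p : (0 <= f p)%E.
  rewrite /f patchE; case: ifPn => //; rewrite inE /A/= => /andP[p0 _].
  by rewrite lee_fin /g mulr_ge0// exprn_ge0.
transitivity (\int[P]_w \int[lebesgue_measure]_t f (w, t))%E.
  apply: eq_integral => w _; rewrite -integral_exprn_itv0o// integral_mkcond.
  apply: eq_integral => t _; rewrite /f !patchE.
  have -> // : (t \in `[0, Y w[%classic) = ((w, t) \in A).
  by rewrite mem_setE in_itv/=; apply/idP/idP => [h|/set_mem//]; exact: mem_set.
rewrite fubini_tonelli// [RHS]integral_mkcond; apply: eq_integral => t _.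
rewrite patchE mem_setE in_itv/= andbT; case: ifPn => t0; last first.
  apply: integral0_eq => w _; rewrite /f patchE memNset// /A/=.
  by rewrite (negbTE t0).
have mt : measurable [set w | t < Y w].
  have : measurable_fun [set: T] (fun w => t < Y w) by exact: measurable_fun_ltr.
  by move=> /(_ measurableT [set true]); rewrite setTI; exact.
transitivity (\int[P]_w ((g t)%:E * (\1_[set w | t < Y w] w)%:E))%E.
  apply: eq_integral => w _; rewrite /f patchE indicE.
  have -> : ((w, t) \in A) = (w \in [set w | t < Y w]).
    by apply/idP/idP; rewrite !inE /A/= t0.
  by case: (w \in _); rewrite ?mule1 ?mule0.
rewrite ge0_integralZl_EFin//.
- by rewrite integral_indic// setIT.
- exact/measurable_EFinP/measurable_indic.
- by rewrite /g mulr_ge0// exprn_ge0.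
Qed.

(** * Termwise integration and the truncation error *)

Lemma integrable_sumR (d : measure_display) (T : measurableType d) (R : realType)
    (mu : {measure set T -> \bar R}) (D : set T) (f : nat -> T -> R) (s : seq nat) :
  measurable D -> (forall i, mu.-integrable D (EFin \o f i)) ->
  mu.-integrable D (EFin \o (fun x => \sum_(i <- s) f i x)).
Proof.
move=> mD fi; rewrite (_ : _ \o _ = (fun x => \sum_(i <- s) (f i x)%:E)%E); last first.
  by apply/funext => x; rewrite sumEFin.
apply: integrable_sum => // i _; exact: fi.
Qed.

Lemma Rintegral_sum (d : measure_display) (T : measurableType d) (R : realType)
    (mu : {measure set T -> \bar R}) (D : set T) (f : nat -> T -> R) (s : seq nat) :
  measurable D -> (forall i, mu.-integrable D (EFin \o f i)) ->
  \int[mu]_(x in D) (\sum_(i <- s) f i x) = \sum_(i <- s) \int[mu]_(x in D) f i x.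
Proof.
move=> mD fi; rewrite /Rintegral.
under eq_integral do rewrite -sumEFin.
rewrite integral_sum// -sum_fine// => i _; exact: integrable_fin_num (fi i).
Qed.

Section tail_moment.
Variables (R : realType) (K : nat).
Local Notation mu := lebesgue_measure.
Local Notation D := (`[0%R, +oo[%classic : set R).

(** The weight k t^(k-1), k = K + 1, times the monomial q^m at q = e^(-t); for m > 0 it integrates
    to k! / m^k. *)
Let phi (m : nat) (t : R) := K.+1%:R * (t ^+ K * expR (- t) ^+ m).

Let phi_ge0 m t : 0 <= t -> 0 <= phi m t.
Proof. by move=> t0; rewrite !mulr_ge0 ?exprn_ge0 ?expR_ge0. Qed.

Let measurable_phi m : measurable_fun [set: R] (phi m).
Proof.
apply: continuous_measurable_fun => t; apply: cvgMr; apply: cvgM.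
  exact: exprn_continuous.
apply: (@continuous_comp _ _ _ (fun t => expR (- t)) (fun x => x ^+ m)).
  by apply: continuous_comp; [exact: continuousN|exact: continuous_expR].
exact: exprn_continuous.
Qed.

Let integral_phi m : (0 < m)%N ->
  (\int[mu]_(t in D) (phi m t)%:E = (K.+1`!%:R / m%:R ^+ K.+1)%:E)%E.
Proof.
move=> m0; have m0' : 0 < m%:R :> R by rewrite ltr0n.
rewrite factS natrM -mulrA EFinM -integral_exprn_expRN//.
rewrite -ge0_integralZl_EFin//.
- by apply: eq_integral => t _; rewrite -EFinM -mulrN expRM_natl.
- move=> t; rewrite /= in_itv/= andbT => t0.
  by rewrite lee_fin mulr_ge0 ?exprn_ge0 ?expR_ge0.
- apply/measurable_EFinP/measurable_funTS; apply: continuous_measurable_fun => t.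
  apply: cvgM; first exact: exprn_continuous.
  apply: continuous_comp; last exact: continuous_expR.
  by apply: continuousN; apply: cvgMr.
Qed.

Let integrable_phi m : (0 < m)%N -> mu.-integrable D (EFin \o phi m).
Proof.
move=> m0; apply/integrableP; split.
  by apply/measurable_EFinP/measurable_funTS; exact: measurable_phi.
suff -> : (\int[mu]_(t in D) `|(EFin \o phi m) t| = \int[mu]_(t in D) (phi m t)%:E)%E.
  by rewrite integral_phi ?ltry.
apply: eq_integral => t; rewrite inE /= in_itv/= andbT => t0.
by rewrite ger0_norm// phi_ge0.
Qed.

Let Rintegral_phi m : (0 < m)%N ->
  \int[mu]_(t in D) phi m t = K.+1`!%:R / m%:R ^+ K.+1.
Proof. by move=> m0; rewrite /Rintegral integral_phi. Qed.

Definition tail_moment (n : nat) (t : R) :=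
  K.+1%:R * t ^+ K * (1 - \prod_(0 <= i < n) (1 - expR (- t) ^+ i.+1)).

(** The pentagonal pair of index s = m + 1; its sign is (-1)^(s+1) because P_n is subtracted from
    1. *)
Let psi (m : nat) (t : R) := (-1) ^+ m *
  (phi (m.+1 ^ 2 + 'C(m.+1, 2)) t + phi (m.+1 ^ 2 + 'C(m.+2, 2)) t).

Let err n t := tail_moment n t - \sum_(0 <= m < n) psi m t.

(** The error consists of the terms s >= 1 on the left of [pentagonal_finite]. For 0 <= q <= 1 their
    partial products lie in [0, 1], and the factor q^(s (s + 1) / 2) is bounded by 1. *)
Let err_le n t : 0 <= t -> `|err n t| <= \sum_(0 <= m < n) phi (m.+1 * n) t.
Proof.
move=> t0; pose q := expR (- t).
have q0 : 0 <= q by exact: expR_ge0.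
have q1 : q <= 1 by rewrite -(expR0 R) ler_expR oppr_le0.
have := pentagonal_finite _ q n; rewrite big_ltn// expr0 mul1r mul0n add0n expr0 mulr1.
rewrite !big_add1/= => pent.
have -> : err n t = \sum_(0 <= m < n) K.+1%:R * t ^+ K * ((-1) ^+ m.+1 *
   (\prod_(m.+1 <= i < n) (1 - q ^+ i.+1)) * q ^+ (m.+1 * n + 'C(m.+2, 2))).
  rewrite -mulr_sumr /err /tail_moment.
  have -> : \sum_(0 <= m < n) psi m t = - (K.+1%:R * t ^+ K *
     \sum_(0 <= m < n) (-1) ^+ m.+1 *
     (q ^+ (m.+1 ^ 2 + 'C(m.+1, 2)) + q ^+ (m.+1 ^ 2 + 'C(m.+2, 2)))).
    rewrite mulr_sumr -sumrN; apply: eq_bigr => m _.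
    by rewrite /psi /phi -/q exprS; ring.
  rewrite opprK -mulrDr; congr (_ * _); rewrite -/q.
  move: pent.
  move: (\prod_(_ <= _ < _) _) (\sum_(_ <= _ < _) _) (\sum_(_ <= _ < _) _).
  by move=> a b c; lra.
apply: (le_trans (ler_norm_sum _ _ _)); apply: ler_sum => m _.
have R01 : 0 <= \prod_(m.+1 <= i < n) (1 - q ^+ i.+1) <= 1.
  have q01 i : 0 <= 1 - q ^+ i.+1 <= 1.
    by rewrite subr_ge0 exprn_ile1// lerBlDr lerDl exprn_ge0.
  rewrite Num.Theory.prodr_ile1 ?prodr_ge0// => i _.
  by case/andP: (q01 i).
case/andP: R01 => R0 R1.
rewrite normrM ger0_norm ?mulr_ge0 ?exprn_ge0//.
rewrite !normrM normrX normrN1 expr1n mul1r !ger0_norm ?exprn_ge0//.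
rewrite /phi -/q -mulrA ler_wpM2l// ler_wpM2l ?exprn_ge0//.
rewrite -[leRHS]mul1r ler_pM ?exprn_ge0//.
by rewrite ler_wiXn2l// leq_addr.
Qed.

Let integrable_psi m : mu.-integrable D (EFin \o psi m).
Proof.
have i1 : mu.-integrable D (EFin \o phi (m.+1 ^ 2 + 'C(m.+1, 2))).
  by apply: integrable_phi; rewrite addn_gt0 expn_gt0.
have i2 : mu.-integrable D (EFin \o phi (m.+1 ^ 2 + 'C(m.+2, 2))).
  by apply: integrable_phi; rewrite addn_gt0 expn_gt0.

exact: (integrableZl _ ((-1) ^+ m) (integrableD _ i1 i2)).
Qed.

Let Rintegral_psi m : \int[mu]_(t in D) psi m t = (-1) ^+ m *
  (K.+1`!%:R / (m.+1 ^ 2 + 'C(m.+1, 2))%:R ^+ K.+1 +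
   K.+1`!%:R / (m.+1 ^ 2 + 'C(m.+2, 2))%:R ^+ K.+1).
Proof.
have i1 : mu.-integrable D (EFin \o phi (m.+1 ^ 2 + 'C(m.+1, 2))).
  by apply: integrable_phi; rewrite addn_gt0 expn_gt0.
have i2 : mu.-integrable D (EFin \o phi (m.+1 ^ 2 + 'C(m.+2, 2))).
  by apply: integrable_phi; rewrite addn_gt0 expn_gt0.
rewrite RintegralZl//; last exact: (integrableD _ i1 i2).
by rewrite RintegralD// !Rintegral_phi// addn_gt0 expn_gt0.
Qed.

Let measurable_tail_moment n : measurable_fun [set: R] (tail_moment n).
Proof.
apply: measurable_funM.
  by apply: continuous_measurable_fun => t; apply: cvgMr; exact: exprn_continuous.
apply: measurable_funB => //; apply: measurable_prod => i _.
apply: measurable_funB => //; apply: measurable_funX.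
apply: continuous_measurable_fun => t.
by apply: continuous_comp; [exact: continuousN|exact: continuous_expR].
Qed.

Let integrable_err n : mu.-integrable D (EFin \o err n).
Proof.
(* For n = 0 the exponents [m.+1 * n] of the dominating functions would be 0, outside the range of
   [integrable_phi]; there [err] vanishes identically. *)
case: n => [|n].
  have -> : EFin \o err 0 = cst 0%E.
    by apply/funext => t /=; rewrite /err /tail_moment !big_geq// subrr mulr0 subr0.
  exact: integrable0.
apply: (@le_integrable _ _ _ mu D _ _
  (EFin \o (fun t => \sum_(0 <= m < n.+1) phi (m.+1 * n.+1) t))) => //.
- apply/measurable_EFinP/measurable_funTS; apply: measurable_funB.
    exact: measurable_tail_moment.
  apply: measurable_sum => m; apply: measurable_funM => //.
  by apply: measurable_funD; exact: measurable_phi.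
- move=> t; rewrite /= in_itv/= andbT => t0; rewrite lee_fin.
  exact: (le_trans (err_le _ t t0) (ler_norm _)).
- by apply: integrable_sumR => // m; exact: integrable_phi.
Qed.

Lemma integrable_tail_moment n : mu.-integrable D (EFin \o tail_moment n).
Proof.
(* Integrability is inherited from the pentagonal terms and the dominated error. *)
rewrite (_ : _ \o _ = (EFin \o (fun t => \sum_(0 <= m < n) psi m t)) \+
    (EFin \o err n)); last first.
  by apply/funext => t /=; rewrite -EFinD /err addrCA subrr addr0.
by apply: integrableD => //; exact: integrable_sumR.
Qed.

Lemma Rintegral_tail_moment_le n :
  `|\int[mu]_(t in D) tail_moment n.+1 t - K.+1`!%:R * \sum_(0 <= m < n.+1)
     (-1) ^+ m * ((m.+1 ^ 2 + 'C(m.+1, 2))%:R ^- K.+1 + (m.+1 ^ 2 + 'C(m.+2, 2))%:R ^- K.+1)|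
  <= K.+1`!%:R * arithmetic_mean (@harmonic R) n.
Proof.
have -> : K.+1`!%:R * \sum_(0 <= m < n.+1)
     (-1) ^+ m * ((m.+1 ^ 2 + 'C(m.+1, 2))%:R ^- K.+1 + (m.+1 ^ 2 + 'C(m.+2, 2))%:R ^- K.+1) =
     \int[mu]_(t in D) (\sum_(0 <= m < n.+1) psi m t).
  rewrite Rintegral_sum// mulr_sumr; apply: eq_bigr => m _.
  by rewrite Rintegral_psi; ring.
rewrite -RintegralB//; [|exact: integrable_tail_moment|exact: integrable_sumR].
apply: (le_trans (le_normr_Rintegral _ _)) => //; first exact: integrable_err.
apply: (@le_trans _ _ (\int[mu]_(t in D) (\sum_(0 <= m < n.+1) phi (m.+1 * n.+1) t))).
  apply: le_Rintegral => //.
  - by have /integrable_norm := integrable_err n.+1.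
  - by apply: integrable_sumR => // m; exact: integrable_phi.
  - by move=> t; rewrite /= in_itv/= andbT; exact: err_le.
rewrite Rintegral_sum//; last by move=> m; exact: integrable_phi.
(* Termwise, ((m + 1) (n + 1))^(-k) <= 1 / ((m + 1) (n + 1)) because k >= 1; the factor 1 / (n + 1)
   is the normalisation of the mean. *)
rewrite /arithmetic_mean/= /series/= !mulr_sumr; apply: ler_sum => m _.
rewrite Rintegral_phi// ler_wpM2l// -invfM -natrM lef_pV2 ?posrE ?exprn_gt0 ?ltr0n//.
by rewrite mulnC -natrX ler_nat -[leqLHS]expn1 leq_pexp2l// muln_gt0.
Qed.

End tail_moment.

(** * Maxima of independent exponential variables *)

Lemma exponential_prob_tail (R : realType) (r t : R) : 0 < r -> 0 <= t ->
  exponential_prob r `]t, +oo[ = (expR (- (r * t)))%:E.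
Proof.
move=> r0 t0; rewrite /exponential_prob.
have cE : continuous (fun x : R => expR (- (r * x))).
  move=> x; apply: continuous_comp; last exact: continuous_expR.
  by apply: continuousN; apply: cvgMr.
pose F x := - expR (- (r * x)).
have dF (x : R) : is_derive x 1 F (r * expR (- (r * x))).
  have d1 : is_derive x 1 (fun s : R => - (r * s)) (- r).
    have -> : (fun s : R => - (r * s)) = horner ((- r) *: 'X).
      by apply/funext => y; rewrite !hornerE; ring.
    by apply: is_derive_eq; rewrite derivZ derivX !hornerE.
  have d2 := @is_derive1_comp R expR _ x _ _ (is_derive_expR _) d1.
  by apply: (is_derive_eq (is_deriveN d2)); ring.
transitivity (\int[lebesgue_measure]_(x in `[t, +oo[) (r * expR (- (r * x)))%:E)%E.
  rewrite -integral_itv_obnd_cbnd; last first.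
    apply/measurable_EFinP/measurable_funTS; apply: continuous_measurable_fun => x.
    by apply: cvgMr; exact: cE.
  apply: eq_integral => x; rewrite inE/= in_itv/= andbT => tx.
  by rewrite exponential_pdfE ?mulNr// ltW// (le_lt_trans t0).
rewrite (@ge0_continuous_FTC2y R _ F t 0).
- by rewrite /F EFinN oppeK add0e.
- by move=> x _; rewrite mulr_ge0 ?expR_ge0// ltW.
- by apply: continuous_subspaceT => x; apply: cvgMr; exact: cE.
- rewrite -oppr0; apply: cvgN.
  have := exprn_expRN_cvg0 _ _ 0 r0.
  by under eq_fun do rewrite expr0 mul1r.
- by move=> x _; exact: ex_derive.
- by apply: cvg_at_right_filter; apply: cvgN; exact: cE.
- by move=> x _; rewrite derive1E derive_val.
Qed.

(** Starting from 0 makes every partial maximum nonnegative at each point, as [integral_exprn_tail]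
    demands, without affecting events [partial_max <= t] for t >= 0. *)
Fixpoint partial_max (d : measure_display) (T : measurableType d)
    (R : realType) (P : probability T R) (X : nat -> {RV P >-> R})
    (n : nat) (w : T) : R :=
  if n is n'.+1 then Num.max (partial_max _ _ _ _ X n' w) (X n w) else 0.

Section partial_max.
Variables (d : measure_display) (T : measurableType d) (R : realType).
Variables (P : probability T R) (X : nat -> {RV P >-> R}).

Local Notation Y := (partial_max _ _ _ _ X).

Lemma measurable_partial_max n : measurable_fun [set: T] (Y n).
Proof.
elim: n => [|n IHn].
  exact: measurable_cst.
by apply: measurable_maxr => //; exact: measurable_funP.
Qed.

Lemma partial_max_le n w (t : R) : 0 <= t ->
  (Y n w <= t) = all (fun i => X i w <= t) (iota 1 n).
Proof.
move=> t0; elim: n => [|n IHn]; first by [].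
have -> : iota 1 n.+1 = iota 1 n ++ [:: n.+1] by rewrite -(addn1 n) iotaD add1n addn1.
by rewrite [LHS]/= ge_max IHn all_cat/= andbT.
Qed.

Lemma partial_max_ge0 n w : 0 <= Y n w.
Proof.
elim: n => [|n IHn]; first by [].
by rewrite /= le_max IHn.
Qed.

Lemma partial_max_nondecreasing w : nondecreasing_seq (Y ^~ w).
Proof.
apply/nondecreasing_seqP => n; rewrite /= le_max lexx//.
Qed.

Hypothesis Xexp : forall i : nat, (0 < i)%N ->
  forall A : set R, measurable A ->
  distribution P (X i) A = exponential_prob (i%:R : R) A.
Hypothesis Xindep : mutually_independent P [set i : nat | (0 < i)%N] X.

Lemma cdf_exponential i (t : R) : (0 < i)%N -> 0 <= t ->
  P (X i @^-1` `]-oo, t]) = (1 - expR (- t) ^+ i)%:E.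
Proof.
move=> i0 t0; have -> : X i @^-1` `]-oo, t] = ~` (X i @^-1` `]t, +oo[).
  by rewrite preimage_setC setCitvr.
rewrite probability_setC; last exact: measurable_funPTI.
rewrite [P _](Xexp _ i0 _ (measurable_itv _)) exponential_prob_tail ?ltr0n//.
by rewrite -mulrN expRM_natl.
Qed.

Lemma partial_max_cdf n (t : R) : 0 <= t ->
  P [set w | Y n w <= t] = (\prod_(0 <= i < n) (1 - expR (- t) ^+ i.+1))%:E.
Proof.
(* For t >= 0 the event is the intersection of the events X_i <= t, 1 <= i <= n, to which
   independence applies. *)
move=> t0; pose J : {fset nat} := [fset i in iota 1 n]%fset.
have -> : [set w | Y n w <= t] = \bigcap_(i in [set` J]) (X i @^-1` `]-oo, t]).
  apply/seteqP; split => w /=.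
    rewrite partial_max_le// => /allP h i iJ; rewrite /= in_itv/=; apply: h.
    by move: iJ; rewrite /= !inE.
  move=> h; rewrite partial_max_le//; apply/allP => i it.
  by have /= := h i; rewrite in_itv/=; apply; rewrite !inE.
rewrite Xindep; last 2 first.
- by move=> i /=; rewrite !inE mem_iota => /andP[].
- by move=> i _; exact: measurable_itv.
rewrite (perm_big (iota 1 n)); last first.
  by apply: uniq_perm; rewrite ?fset_uniq ?iota_uniq// => i; rewrite !inE.
rewrite big_seq (eq_bigr (fun i => (1 - expR (- t) ^+ i)%:E)); last first.
  by move=> i; rewrite mem_iota => /andP[i1 _]; rewrite cdf_exponential.
rewrite -big_seq prodEFin; congr EFin.
by rewrite (_ : iota 1 n = index_iota 1 n.+1) ?big_add1// /index_iota subn1.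
Qed.

Lemma expectation_partial_max K n :
  (\int[P]_w (Y n w ^+ K.+1)%:E =
   (\int[lebesgue_measure]_(t in `[0%R, +oo[) tail_moment R K n t)%:E)%E.
Proof.
rewrite integral_exprn_tail; last 2 first.
- exact: measurable_partial_max.
- exact: partial_max_ge0.
rewrite /Rintegral fineK; last exact: integrable_fin_num (integrable_tail_moment _ _ _).
apply: eq_integral => t; rewrite inE/= in_itv/= andbT => t0.
rewrite /tail_moment [RHS]EFinM; congr (_ * _)%E.
have -> : [set w | t < Y n w] = ~` [set w | Y n w <= t].
  by apply/seteqP; split => w /=; rewrite ltNge => /negP.
rewrite probability_setC ?partial_max_cdf//.
have := measurable_partial_max n; move=> /(_ measurableT `]-oo, t]%classic).
rewrite setTI (_ : _ @^-1` _ = [set w | Y n w <= t]).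
  by apply; exact: measurable_itv.
by apply/seteqP; split => w /=; rewrite in_itv.
Qed.

End partial_max.

(** * Passage from partial maxima to the supremum *)

Lemma measurable_supRV (d : measure_display) (T : measurableType d)
    (R : realType) (P : probability T R) (X : nat -> {RV P >-> R}) :
  measurable_fun [set: T] (supRV P X).
Proof.
apply: (measurable_fun_esups (f := fun i w => (X i w)%:E) _ 1) => i.
by apply/measurable_EFinP; exact: measurable_funP.
Qed.

Lemma emeasurable_funX (d : measure_display) (T : measurableType d)
    (R : realType) (D : set T) (f : T -> \bar R) (n : nat) :
  measurable_fun D f -> measurable_fun D (fun w => (f w ^+ n)%E).
Proof.
move=> mf; elim: n => [|n IHn]; first exact: measurable_cst.
by under eq_fun do rewrite expeS; exact: emeasurable_funM.
Qed.

(** Products of limits can fail only in the form 0 times infinity. For l >= 0 this never arises: [l]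
    and its powers are all finite, or l = +oo and its powers are 1 or +oo. *)
Lemma cvge_expe (R : realType) (u : nat -> \bar R) (l : \bar R) (n : nat) :
  (0 <= l)%E -> u @ \oo --> l -> (fun m => (u m ^+ n)%E) @ \oo --> (l ^+ n)%E.
Proof.
move=> l0 ul; elim: n => [|n IHn]; first exact: cvg_cst.
rewrite expeS; under eq_fun do rewrite expeS.
apply: cvgeM => //; case: l l0 {ul IHn} => [r| |]// r0.
  by rewrite -EFin_expe mule_def_fin.
case: n => [|n]; first by apply: mule_def_infty_neq0 => //; exact: onee_neq0.
by rewrite (_ : (+oo ^+ n.+1)%E = +oo%E)//; elim: n => // n IHn; rewrite expeS IHn.
Qed.

Section expectation_supremum.
Variables (d : measure_display) (T : measurableType d) (R : realType).
Variables (P : probability T R) (X : nat -> {RV P >-> R}).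

Local Notation Y := (partial_max _ _ _ _ X).

(** The sign condition keeps the starting value 0 of the maxima below the supremum; monotonicity
    does the rest. *)
Lemma partial_max_cvg_supRV w : 0 <= X 1 w ->
  (fun n => (Y n w)%:E) @ \oo --> supRV P X w.
Proof.
move=> X1.
have -> : supRV P X w = ereal_sup (range (fun n => (Y n w)%:E)).
  apply/eqP; rewrite eq_le; apply/andP; split.
  - apply: ge_ereal_sup => _ [[//|i] _ <-].
    apply: (@le_trans _ _ (Y i.+1 w)%:E).
      by rewrite lee_fin /= le_max lexx orbT.
    by apply: ereal_sup_ubound; exists i.+1.
  - apply: ge_ereal_sup => _ [n _ <-].
    have sup_ge i : (0 < i)%N -> ((X i w)%:E <= supRV P X w)%E.
      by move=> i0; apply: ereal_sup_ubound; exists i.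
    elim: n => [|n IHn].
      by apply: le_trans (sup_ge 1%N _) => //; rewrite lee_fin.
    rewrite /=; case: (leP (Y n w) (X n.+1 w)) => _ //.
    exact: sup_ge.
apply: ereal_nondecreasing_cvgn => m n mn; rewrite lee_fin.
exact: partial_max_nondecreasing.
Qed.

Hypothesis X1_ge0 : P (X 1 @^-1` `]-oo, 0]) = 0%E.

(** Monotone convergence, after replacing the supremum by the limit of the maxima off the null event
    X_1 <= 0. *)
Lemma expectation_partial_max_cvg K :
  (fun n => \int[P]_w (Y n w ^+ K.+1)%:E)%E @ \oo -->
  (\int[P]_w (supRV P X w ^+ K.+1))%E.
Proof.
have mY n : measurable_fun [set: T] (fun w => (Y n w ^+ K.+1)%:E).
  by apply/measurable_EFinP/measurable_funX; exact: measurable_partial_max.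
have ndY w : {homo (fun n => (Y n w ^+ K.+1)%:E) : n m / (n <= m)%N >-> (n <= m)%E}.
  move=> m n mn; rewrite lee_fin lerXn2r ?nnegrE ?partial_max_ge0//.
  exact: partial_max_nondecreasing.
have -> : (\int[P]_w (supRV P X w ^+ K.+1) =
    \int[P]_w limn (fun n => (Y n w ^+ K.+1)%:E))%E.
  apply: ae_eq_integral => //.
  - by apply: emeasurable_funX; exact: measurable_supRV.
  - apply: (emeasurable_fun_cvg _ _ mY) => w _.
    by apply: ereal_nondecreasing_is_cvgn; exact: ndY.
  - exists (X 1 @^-1` `]-oo, 0]); split => //.
      exact: measurable_funPTI.
    move=> w /=; apply: contra_notP; rewrite in_itv/= => /negP; rewrite -ltNge => X1w _.
    have sup_ge0 : (0 <= supRV P X w)%E.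
      apply: le_trans (ereal_sup_ubound _); last by exists 1%N.
      by rewrite lee_fin ltW.
    apply/esym/cvg_lim => //; under eq_fun do rewrite EFin_expe.
    exact: (cvge_expe _ _ _ K.+1 sup_ge0 (partial_max_cvg_supRV w (ltW X1w))).
apply: cvg_monotone_convergence => // n w _.
by rewrite lee_fin exprn_ge0// partial_max_ge0.
Qed.

End expectation_supremum.

(** * Comparison of the two limits along even indices *)

Theorem theorem2 (R : realType) (d : measure_display) (T : measurableType d)
  (P : probability T R) (X : nat -> {RV P >-> R})
  (Xexp : forall i : nat, (0 < i)%N ->
     forall A : set R, measurable A ->
       distribution P (X i) A = exponential_prob (i%:R : R) A)
  (Xindep : mutually_independent P [set i : nat | (0 < i)%N] X)
  (k : nat) (hk : (1 <= k)%N) :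
  (\int[P]_w (supRV P X w ^+ k))%E =
  (k`!%:R * (-1) ^+ k *
    ( - (6 ^+ k * (2 * pi / (3 * Num.sqrt 3) - 1) * 'C(2 * k - 2, k - 1)%:R)
      + \sum_(1 <= j < k./2.+1)
          (2 ^+ k.+1 * 'C(2 * k - 2 * j - 1, k - 1)%:R * 3 ^+ (k - 2 * j)
           * riemann_zeta (2 * j) * (1 - (2 ^+ (2 * j - 1))^-1))
      + \sum_(2 <= j < k.+1)
          ('C(2 * k - j - 1, k - 1)%:R * 6 ^+ (k - j) *
           ((-1) ^+ j * (hurwitz_zeta j (1 / 3) - hurwitz_zeta j (5 / 6))
            + hurwitz_zeta j (2 / 3) - hurwitz_zeta j (1 / 6) + 6 ^+ j))))%:E.
Proof.
case: k hk => // K _; rewrite -mulrA.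
set S := (-1) ^+ K.+1 * _.
have Scvg : (fun n => \sum_(0 <= m < n.*2) (-1) ^+ m *
     ((m.+1 ^ 2 + 'C(m.+1, 2))%:R ^- K.+1 + (m.+1 ^ 2 + 'C(m.+2, 2))%:R ^- K.+1)) @ \oo --> S.
  exact: pentagonal_series_cvg.
pose A (n : nat) : R := \sum_(0 <= m < n) (-1) ^+ m *
     ((m.+1 ^ 2 + 'C(m.+1, 2))%:R ^- K.+1 + (m.+1 ^ 2 + 'C(m.+2, 2))%:R ^- K.+1).
pose I (n : nat) : R := \int[lebesgue_measure]_(t in `[0%R, +oo[) tail_moment R K n t.
have IA : (fun n => I n - K.+1`!%:R * A n) @ \oo --> (0 : R).
  (* The error estimate is stated at n + 1; its bound tends to 0 by Cesaro's theorem, since the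
     harmonic sequence does. *)
  rewrite -cvg_shiftS; apply: norm_cvg0.
  apply: (@squeeze_cvgr _ _ _ _ (fun=> 0)
    (fun n => K.+1`!%:R * arithmetic_mean (@harmonic R) n)).
  - by near=> n; rewrite normr_ge0/= Rintegral_tail_moment_le.
  - exact: cvg_cst.
  - rewrite -(mulr0 K.+1`!%:R); apply: cvgMr; apply: cesaro; exact: cvg_harmonic.
have Icvg : (fun n => I n.*2) @ \oo --> K.+1`!%:R * S.
  have -> : (fun n => I n.*2) =
      (fun n => (I n.*2 - K.+1`!%:R * A n.*2) + K.+1`!%:R * A n.*2).
    by apply/funext => n; rewrite subrK.
  rewrite -(add0r (K.+1`!%:R * S)); apply: cvgD; last exact: cvgMr.
  exact: (cvg_double _ (fun n => I n - K.+1`!%:R * A n)).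
have X1_ge0 : P (X 1 @^-1` `]-oo, 0]) = 0%E.
  by rewrite (cdf_exponential _ _ _ _ _ Xexp)// oppr0 expR0 expr1n subrr.
(* The moments of the maxima converge along all indices, the closed form is known along even ones;
   uniqueness of the limit on even indices identifies the two. *)
have := cvg_double _ _ _ (expectation_partial_max_cvg _ _ _ _ _ X1_ge0 K).
under eq_fun do rewrite (expectation_partial_max _ _ _ _ _ Xexp Xindep).
move=> /cvg_unique; apply => //.
by apply: cvg_EFin; first exact: nearW.
Unshelve. all: by end_near. Qed.
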